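(* Let $k$ be an algebraically closed field of characteristic zero and let $q \in k$ be a root of unity of odd order $N > 1$. Then $$\nu_2(u_q(\mathfrak{sl}_2)) = \frac{4}{(1+q)(1+q^{-1})}.$$
   Context: For a finite-dimensional Hopf algebra $H$ with antipode $S$, the second indicator is $\nu_2(H) = \mathrm{Tr}(S: H \to H) \in k$. For a root of unity $q \in k$ of odd order $N > 1$, $u_q(\mathfrak{sl}_2)$ is the Hopf algebra over $k$ generated as an algebra by $E, F, K$ with relations $E^N = F^N = 0$, $K^N = 1$, $KE = q^2EK$, $KF = q^{-2}FK$, $EF - FE = (K - K^{N-1})/(q - q^{-1})$, with comultiplication $\Delta(E) = E\otimes1 + K\otimes E$, $\Delta(F) = F\otimes K^{-1} + 1\otimes F$, $\Delta(K) = K\otimes K$. *)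

(* Defs.v *)
From HB Require Import structures.
From mathcomp Require Import all_boot all_order all_algebra all_field.

Set Implicit Arguments.
Unset Strict Implicit.
Unset Printing Implicit Defensive.

Import GRing.Theory.
Local Open Scope ring_scope.

Section Trace.
Variables (k : fieldType) (V : vectType k).

Definition lfun_trace (f : 'End(V)) : k :=
  \tr (passmx.mxof (vbasis {:V}) (vbasis {:V}) f).

End Trace.

Section TensorSpace.
Variable k : fieldType.

(* The tensor product of finite-dimensional spaces, in coordinates: the entry
   (i, j) of a tensor is its coefficient on e_i (x) f_j, for the bases
   e := vbasis {:U} and f := vbasis {:V}. tlift_pure and pure_ext below are the
   universal property that characterises the tensor product. *)
Definition tensor (U V : vectType k) : Type :=
  'M[k]_(\dim {:U}, \dim {:V}).

HB.instance Definition _ (U V : vectType k) := Vector.copy (tensor U V)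
  'M[k]_(\dim {:U}, \dim {:V}).

Definition pure (U V : vectType k) (u : U) (v : V) : tensor U V :=
  \matrix_(i, j) (coord (vbasis {:U}) i u * coord (vbasis {:V}) j v).

(* For f bilinear, the linear map U (x) V -> W sending pure u v to f u v. *)
Definition tlift (U V : vectType k) (W : lmodType k) (f : U -> V -> W)
    (t : tensor U V) : W :=
  \sum_i \sum_j t i j *: f (vbasis {:U})`_i (vbasis {:V})`_j.

Section Theory.
Variables (U V : vectType k) (W : lmodType k).

Lemma pure_is_linearl (v : V) : linear (@pure U V ^~ v).
Proof.
by move=> a u u'; apply/matrixP=> i j; rewrite !mxE linearP mulrDl mulrA.
Qed.

Lemma pure_is_linearr (u : U) : linear (@pure U V u).
Proof.
by move=> a v v'; apply/matrixP=> i j; rewrite !mxE linearP mulrDr mulrCA.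
Qed.

Lemma tlift_is_linear (f : U -> V -> W) : linear (tlift f).
Proof.
move=> a s t; rewrite /tlift scaler_sumr -big_split; apply: eq_bigr => i _ /=.
rewrite scaler_sumr -big_split; apply: eq_bigr => j _ /=.
by rewrite !mxE scalerDl scalerA.
Qed.

HB.instance Definition _ (f : U -> V -> W) :=
  GRing.isLinear.Build k (tensor U V) W _ (tlift f) (tlift_is_linear f).

Lemma tlift_pure (f : U -> V -> W) :
    (forall v, linear (f ^~ v)) -> (forall u, linear (f u)) ->
  forall u v, tlift f (pure u v) = f u v.
Proof.
move=> fl fr u v.
pose fL v' : {linear U -> W} :=
  HB.pack (f ^~ v') (GRing.isLinear.Build k U W _ (f ^~ v') (fl v')).
pose fR u' : {linear V -> W} :=
  HB.pack (f u') (GRing.isLinear.Build k V W _ (f u') (fr u')).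
rewrite [u in RHS](coord_vbasis (memvf u)) [v in RHS](coord_vbasis (memvf v)).
rewrite -[RHS]/(fL _ _) linear_sum; apply: eq_bigr => i _.
rewrite linearZ /= -[f _ _]/(fR _ _) linear_sum scaler_sumr.
by apply: eq_bigr => j _; rewrite linearZ /= scalerA mxE.
Qed.

Lemma pure_basis_sum (t : tensor U V) :
  t = \sum_i \sum_j t i j *: pure (vbasis {:U})`_i (vbasis {:V})`_j.
Proof.
have cE (X : vectType k) (i l : 'I_(\dim {:X})) :
    coord (vbasis {:X}) i (vbasis {:X})`_l = (l == i)%:R.
  by rewrite coord_free ?(basis_free (vbasisP _)) // eq_sym.
rewrite [LHS](@matrix_sum_delta k); apply: eq_bigr => i _.
apply: eq_bigr => j _; congr (_ *: _); apply/matrixP=> i' j'.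
by rewrite !mxE !cE -natrM mulnb ![_ == i']eq_sym ![_ == j']eq_sym.
Qed.

Lemma pure_ext (f g : {linear tensor U V -> W}) :
  (forall u v, f (pure u v) = g (pure u v)) -> f =1 g.
Proof.
move=> fg t; rewrite (pure_basis_sum t) !linear_sum; apply: eq_bigr => i _.
by rewrite !linear_sum; apply: eq_bigr => j _; rewrite !linearZ /= fg.
Qed.

End Theory.

Definition tassoc (U V W : vectType k) :
    tensor (tensor U V) W -> tensor U (tensor V W) :=
  tlift (fun t w => tlift (fun u v => pure u (pure v w)) t).

Definition tmap (U V U' V' : vectType k) (f : U -> U') (g : V -> V') :
    tensor U V -> tensor U' V' :=
  tlift (fun u v => pure (f u) (g v)).

End TensorSpace.

Notation "u ⊗ v" := (pure u v) (at level 40, left associativity) : ring_scope.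

Section TensorAlgebra.
Variables (k : fieldType) (A B : falgType k).
Local Notation T := (tensor A B).

Definition tmul (s t : T) : T :=
  tlift (fun a b => tlift (fun a' b' => (a * a') ⊗ (b * b')) t) s.
Definition tone : T := 1 ⊗ 1.

Lemma tmul_is_linearl (t : T) : linear (tmul ^~ t).
Proof. exact: tlift_is_linear. Qed.

Lemma tmul_is_linearr (s : T) : linear (tmul s).
Proof.
move=> c t t'; pose g a b := tlift (fun a' b' => (a * a') ⊗ (b * b') : T).
have gE r : tmul s r =
    \sum_i \sum_j s i j *: g (vbasis {:A})`_i (vbasis {:B})`_j r by [].
rewrite !gE scaler_sumr -big_split; apply: eq_bigr => i _ /=.
rewrite scaler_sumr -big_split; apply: eq_bigr => j _ /=.
by rewrite [g _ _ _]tlift_is_linear scalerDr !scalerA mulrC.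
Qed.

Lemma tmul_pure a b a' b' : tmul (a ⊗ b) (a' ⊗ b') = (a * a') ⊗ (b * b').
Proof.
have mE u v : tlift (fun x y => (u * x) ⊗ (v * y)) (a' ⊗ b')
              = (u * a') ⊗ (v * b').
  rewrite tlift_pure // => [y|x] c z z'.
    by rewrite mulrDr -scalerAr pure_is_linearl.
  by rewrite mulrDr -scalerAr pure_is_linearr.
rewrite /tmul tlift_pure ?mE // => [v|u] c z z'; rewrite !mE mulrDl -scalerAl.
  exact: pure_is_linearl.
exact: pure_is_linearr.
Qed.

Let lft (t : T) : {linear T -> T} :=
  HB.pack (tmul ^~ t) (GRing.isLinear.Build k T T _ (tmul ^~ t)
    (tmul_is_linearl t)).
Let rgt (s : T) : {linear T -> T} :=
  HB.pack (tmul s) (GRing.isLinear.Build k T T _ (tmul s) (tmul_is_linearr s)).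

Lemma tmulA : associative tmul.
Proof.
move=> r s t.
apply: (pure_ext (f := lft (tmul s t)) (g := lft t \o lft s) _ r) => a b /=.
apply: (pure_ext (f := rgt (a ⊗ b) \o lft t)
  (g := lft t \o rgt (a ⊗ b)) _ s) => a' b' /=.
apply: (pure_ext (f := rgt (a ⊗ b) \o rgt (a' ⊗ b'))
  (g := rgt (tmul (a ⊗ b) (a' ⊗ b'))) _ t) => a'' b'' /=.
by rewrite !tmul_pure !mulrA.
Qed.

Lemma tmul1r : left_id tone tmul.
Proof.
move=> t; apply: (pure_ext (f := rgt tone) (g := idfun) _ t) => a b /=.
by rewrite tmul_pure !mul1r.
Qed.

Lemma tmulr1 : right_id tone tmul.
Proof.
move=> t; apply: (pure_ext (f := lft tone) (g := idfun) _ t) => a b /=.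
by rewrite tmul_pure !mulr1.
Qed.

Lemma tmulDl : left_distributive tmul +%R.
Proof. by move=> s s' t; exact: (linearD (lft t)). Qed.

Lemma tmulDr : right_distributive tmul +%R.
Proof. by move=> s t t'; exact: (linearD (rgt s)). Qed.

Lemma tone_neq0 : tone != 0.
Proof.
have coord1 (X : falgType k) : exists i, coord (vbasis {:X}) i 1 != 0.
  apply/existsP; rewrite -negb_forall; apply: contra (oner_neq0 X) => /forallP c0.
  rewrite (coord_vbasis (memvf 1)) big1 // => i _.
  by rewrite (eqP (c0 i)) scale0r.
have [[i ai] [j bj]] := (coord1 A, coord1 B).
apply/eqP => /matrixP /(_ i j); rewrite !mxE => /eqP.
by rewrite mulf_eq0 (negPf ai) (negPf bj).
Qed.

HB.instance Definition _ := GRing.Zmodule_isNzRing.Build T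
  tmulA tmul1r tmulr1 tmulDl tmulDr tone_neq0.

Lemma tensor_scalerAl (c : k) (s t : T) : c *: (s * t) = (c *: s) * t.
Proof. exact: esym (linearZZ (lft t) c s). Qed.

HB.instance Definition _ := GRing.Lmodule_isLalgebra.Build k T tensor_scalerAl.

Lemma tensor_scalerAr (c : k) (s t : T) : c *: (s * t) = s * (c *: t).
Proof. exact: esym (linearZZ (rgt s) c t). Qed.

HB.instance Definition _ := GRing.Lalgebra_isAlgebra.Build k T tensor_scalerAr.
HB.instance Definition _ := Algebra_isFalgebra.Build k T.

Lemma pureM (a a' : A) (b b' : B) : (a ⊗ b) * (a' ⊗ b') = (a * a') ⊗ (b * b').
Proof. exact: tmul_pure. Qed.

End TensorAlgebra.

Record hopfAlg (k : fieldType) := HopfAlg {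
  hopf_sort :> falgType k;
  comult : 'AHom(hopf_sort, tensor hopf_sort hopf_sort);
  counit : 'AHom(hopf_sort, k^o);
  antipode : 'End(hopf_sort);
  comultA : forall x,
    tassoc (tmap comult id (comult x)) = tmap id comult (comult x);
  counitl : forall x, tlift (fun a b => (counit a : k) *: b) (comult x) = x;
  counitr : forall x, tlift (fun a b => (counit b : k) *: a) (comult x) = x;
  antipodel : forall x,
    tlift (fun a b => antipode a * b) (comult x) = (counit x : k)%:A;
  antipoder : forall x,
    tlift (fun a b => a * antipode b) (comult x) = (counit x : k)%:A
}.

Definition nu2 (k : fieldType) (H : hopfAlg k) : k := lfun_trace (antipode H).

Section Uqsl2.
Variables (k : fieldType) (N : nat) (q : k).

Record uqsl2_rels (A : algType k) (E F K : A) : Prop := UqSl2Rels {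
  uqsl2_E_nilp : E ^+ N = 0;
  uqsl2_F_nilp : F ^+ N = 0;
  uqsl2_K_unip : K ^+ N = 1;
  uqsl2_KE : K * E = q ^+ 2 *: (E * K);
  uqsl2_KF : K * F = q ^- 2 *: (F * K);
  uqsl2_EF : E * F - F * E = (q - q^-1)^-1 *: (K - K ^+ (N - 1))
}.

(* U is presented, as an algebra, by the generators E, F, K and the above
   relations: it is initial among algebras with three such elements. *)
Definition uqsl2_presentation (U : algType k) (E F K : U) : Prop :=
  uqsl2_rels E F K /\
  forall (A : algType k) (e f h : A), uqsl2_rels e f h ->
    exists phi : {lrmorphism U -> A},
      [/\ phi E = e, phi F = f & phi K = h] /\
      forall psi : {lrmorphism U -> A},
        [/\ psi E = e, psi F = f & psi K = h] -> psi =1 phi.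

(* The Hopf algebra U is u_q(sl_2), with standard generators E, F, K. The
   counit and the antipode are determined by the comultiplication. *)
Record is_uqsl2 (U : hopfAlg k) (E F K : U) : Prop := IsUqSl2 {
  uqsl2_pres : uqsl2_presentation E F K;
  uqsl2_comultE : comult U E = E ⊗ 1 + K ⊗ E;
  uqsl2_comultF : comult U F = F ⊗ K^-1 + 1 ⊗ F;
  uqsl2_comultK : comult U K = K ⊗ K
}.

End Uqsl2.

(* Main.v *)
From HB Require Import structures.
Require Import Defs.
From mathcomp Require Import all_boot all_order all_algebra all_field.
From mathcomp Require Import ring.

(** The antipode satisfies S(yK) = K^-1 S(y), S(yE) = - K^-1 E S(y) and
    S(yF) = - F K S(y), because a linear map f with f * id = c eps for the
    convolution product equals c S. Hence S(F^a K^c E^b) is, up to sign,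
    (K^-1 E)^b K^-c (F K)^a, and the trace only sees its coefficient on
    F^a K^c E^b.

    The relations show that the monomials F^a K^c E^b with a, b, c < N span.
    Their coordinates are read off N representations of dimension N^2, the
    blocks of the right regular representation: for j < N, the basis (w_ab)
    with w_ab E = w_(a,b+1), w_ab K = q^(j+2a-2b) w_ab and
    w_ab F = w_(a+1,b) + (scalar) w_(a,b-1), where w_00 F^a K^c E^b is
    q^((j+2a)c) w_ab. The word (K^-1 E)^b K^-c (F K)^a sends w_00 to a multiple
    of w_ab plus terms w_(a',b') with b' < b. Averaging over j leaves a sum over
    c that selects the unique c with 2c = a - b modulo N, and the trace is the
    sum of (-q)^a (-q^-1)^b over a, b < N. *)

Set Implicit Arguments.
Unset Strict Implicit.
Unset Printing Implicit Defensive.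

Import GRing.Theory FalgLfun.
Local Open Scope ring_scope.

(** * Traces from a resolution of the identity *)

Section Trace.
Variables (k : fieldType) (V : vectType k).

Lemma lfun_trace_coord (f : 'End(V)) :
  lfun_trace f = \sum_i coord (vbasis {:V}) i (f (vbasis {:V})`_i).
Proof.
apply: eq_bigr => i _; rewrite !mxE /passmx.vecof /=.
by congr (coord _ _ (f _)); rewrite (bigD1 i) //= big1 => [|j ji];
  rewrite !mxE eqxx ?eqxx ?scale1r ?addr0 //= (negPf ji) scale0r.
Qed.

(** The map [f] is the sum of the rank-one maps sending [v] to [l i v *: f (m i)], and such a map
    has trace [l i (f (m i))]. *)
Lemma lfun_trace_expansion (I : finType) (m : I -> V) (l : I -> V -> k)
    (f : 'End(V)) :
  (forall i, scalar (l i)) -> (forall v, v = \sum_i l i v *: m i) ->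
  lfun_trace f = \sum_i l i (f (m i)).
Proof.
move=> l_scalar lmK.
pose L i : {scalar V} :=
  HB.pack (l i) (GRing.isLinear.Build k V k _ (l i) (l_scalar i)).
rewrite lfun_trace_coord.
under eq_bigr => j _ do rewrite [in f _](lmK (vbasis {:V})`_j) !linear_sum.
rewrite exchange_big; apply: eq_bigr => i _ /=.
rewrite -[RHS]/(L i (f (m i))) [f (m i) in RHS](coord_vbasis (memvf _)).
rewrite linear_sum.
by apply: eq_bigr => j _; rewrite !linearZ /= mulrC.
Qed.

End Trace.

(** * Linear and multiplicative calculus of [tlift] *)

Section TensorLift.
Variables (k : fieldType) (U V : vectType k).

Lemma eq_tlift (W : lmodType k) (f g : U -> V -> W) (t : tensor U V) :
  (forall u v, f u v = g u v) -> tlift f t = tlift g t.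
Proof.
by move=> fg; apply: eq_bigr => i _; apply: eq_bigr => j _; rewrite fg.
Qed.

Lemma linear_tlift (W W' : lmodType k) (g : {linear W -> W'})
    (f : U -> V -> W) (t : tensor U V) :
  g (tlift f t) = tlift (fun u v => g (f u v)) t.
Proof.
rewrite /tlift linear_sum; apply: eq_bigr => i _; rewrite linear_sum.
by apply: eq_bigr => j _; rewrite linearZ.
Qed.

Lemma tliftP (X W : lmodType k) (f : X -> U -> V -> W) (t : tensor U V) :
  (forall u v, linear (fun x => f x u v)) -> linear (fun x => tlift (f x) t).
Proof.
move=> fl c x y; rewrite /tlift scaler_sumr -big_split; apply: eq_bigr => i _.
rewrite scaler_sumr -big_split; apply: eq_bigr => j _ /=.
by rewrite fl scalerDr !scalerA mulrC.
Qed.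

End TensorLift.

Lemma tassoc_pure (k : fieldType) (U V W : vectType k) (t : tensor U V)
    (w : W) :
  tassoc (t ⊗ w) = tlift (fun u v => u ⊗ (v ⊗ w)) t.
Proof.
rewrite /tassoc tlift_pure // => [v|s]; first exact: tlift_is_linear.
apply: (tliftP (f := fun w u v => u ⊗ (v ⊗ w))) => r v z w1 w2.
by rewrite !pure_is_linearr.
Qed.

Lemma tlift_mul_pure (k : fieldType) (A B : falgType k) (W : lmodType k)
    (f : A -> B -> W) (t : tensor A B) (c : A) (d : B) :
  (forall v, linear (f ^~ v)) -> (forall u, linear (f u)) ->
  tlift f (t * (c ⊗ d)) = tlift (fun a b => f (a * c) (b * d)) t.
Proof.
move=> fl fr; rewrite [t * _]/(tmul t (c ⊗ d)) /tmul linear_tlift.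
apply: eq_tlift => a b; rewrite tlift_pure => [|u r x y|u r x y].
- exact: tlift_pure.
- by rewrite mulrDr -scalerAr pure_is_linearl.
- by rewrite mulrDr -scalerAr pure_is_linearr.
Qed.

Lemma mull_tlift (k : fieldType) (U V : vectType k) (A : falgType k)
    (f : U -> V -> A) (t : tensor U V) (x : A) :
  x * tlift f t = tlift (fun u v => x * f u v) t.
Proof.
rewrite /tlift mulr_sumr; apply: eq_bigr => i _; rewrite mulr_sumr.
by apply: eq_bigr => j _; rewrite scalerAr.
Qed.

Lemma mulr_tlift (k : fieldType) (U V : vectType k) (A : falgType k)
    (f : U -> V -> A) (t : tensor U V) (x : A) :
  tlift f t * x = tlift (fun u v => f u v * x) t.
Proof.
rewrite /tlift mulr_suml; apply: eq_bigr => i _; rewrite mulr_suml.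
by apply: eq_bigr => j _; rewrite scalerAl.
Qed.

(** * The antipode on products with grouplike and skew-primitive elements *)

Section Antipode.
Variables (k : fieldType) (H : hopfAlg k).
Local Notation S := (antipode H).
Local Notation D := (comult H).
Local Notation eps := (counit H).

(* The antipode is the convolution inverse of the identity, so it can be
   cancelled from a convolution product f * id = c eps. *)
Lemma convolution_id_inj (f : {linear H -> H}) (c : H) :
    (forall x, tlift (fun a b => f a * b) (D x) = (eps x : k) *: c) ->
  forall x, f x = c * S x.
Proof.
move=> fc x.
(* [Phi] evaluates the convolution f * id * S on threefold tensors; coassociativity allows either
   bracketing. *)
pose Phi : tensor H (tensor H H) -> H :=
  tlift (fun a s => tlift (fun b d => f a * (b * S d)) s).
have PhiE a s : Phi (a ⊗ s) = tlift (fun b d => f a * (b * S d)) s.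
  rewrite /Phi tlift_pure // => [v|u]; last exact: tlift_is_linear.
  apply: (tliftP (f := fun a b d => f a * (b * S d))) => u w z r r'.
  by rewrite linearP mulrDl -scalerAl.
(* Bracketing id * S first produces the counit, which leaves [f x]. *)
transitivity (Phi (tmap id D (D x))).
  rewrite /tmap [in RHS]/Phi linear_tlift -/Phi.
  rewrite -{1}[x](counitr (h := H)) linear_tlift; apply: eq_tlift => a b.
  by rewrite /= -/Phi PhiE -mull_tlift antipoder linearZ -scalerAr mulr1.
(* Bracketing f * id first produces c eps by hypothesis, which leaves [c * S x]. *)
rewrite -comultA /tmap [tassoc _]linear_tlift [Phi _]linear_tlift.
rewrite -[in RHS](counitl (h := H) x) linear_tlift mull_tlift.
apply: eq_tlift => a b; rewrite /= -/Phi -/(tassoc _) tassoc_pure.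
rewrite [Phi _]linear_tlift linearZ -scalerAr scalerAl -fc mulr_tlift.
apply: eq_tlift => u v; rewrite /= -/Phi PhiE.
rewrite tlift_pure => [|d z y y'|d z y y'].
- exact: mulrA.
- by rewrite mulrDl mulrDr -scalerAl -scalerAr.
- by rewrite linearP !mulrDr -!scalerAr.
Qed.
Lemma antipodel_is_linearl (b : H) : linear (fun a : H => S a * b).
Proof. by move=> z y y'; rewrite linearP mulrDl scalerAl. Qed.

Lemma antipodel_is_linearr (a : H) : linear (fun b : H => S a * b : H).
Proof. by move=> z y y'; rewrite mulrDr scalerAr. Qed.

#[local] Hint Resolve antipodel_is_linearl antipodel_is_linearr : core.

Lemma antipode1 : S 1 = 1.
Proof.
have := antipodel (h := H) 1; rewrite !rmorph1 scale1r.
by rewrite -[1 in LHS]/(1 ⊗ 1) tlift_pure ?mulr1.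
Qed.

Lemma counit_tlift_pure (a b : H) :
  tlift (fun a b => (eps a : k) *: b) (a ⊗ b) = (eps a : k) *: b.
Proof.
apply: tlift_pure => [v|u] z y y'; last by rewrite scalerDr !scalerA mulrC.
by rewrite linearP scalerDl scalerA.
Qed.

Lemma counit_grouplike (g : H) :
  g \is a GRing.unit -> D g = g ⊗ g -> eps g = 1.
Proof.
move=> ug Dg; have := counitl (h := H) g; rewrite Dg counit_tlift_pure.
move/(congr1 ( *%R^~ g^-1)); rewrite -scalerAl divrr // -{2}[1]scale1r.
move/eqP; rewrite -subr_eq0 -scalerBl scaler_eq0 oner_eq0 orbF subr_eq0.
by move/eqP.
Qed.

Lemma antipode_amulrE x y : (S \o amulr x)%VF y = S (y * x).
Proof. by rewrite comp_lfunE /amulr lfunE. Qed.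

(** Inserting g g^-1 on the right, the convolution of S(_ g) with id at x is eps(xg) g^-1 = eps(x)
    g^-1, so cancellation applies with c = g^-1. *)
Lemma antipode_mulr_grouplike (g x : H) :
  g \is a GRing.unit -> D g = g ⊗ g -> S (x * g) = g^-1 * S x.
Proof.
move=> ug Dg; rewrite -antipode_amulrE; apply: convolution_id_inj => {}x.
transitivity (tlift (fun a b => S a * b) (D (x * g)) * g^-1).
  rewrite rmorphM /= Dg tlift_mul_pure // mulr_tlift; apply: eq_tlift => a b.
  by rewrite antipode_amulrE mulrA mulrK.
rewrite antipodel rmorphM /= (counit_grouplike ug Dg) mulr1.
by rewrite -scalerAl mul1r.
Qed.

(** With f = S(_ x), the antipode axiom at yx reads 0 = (f * id)(y) g + eps(y) h^-1 x. Solving for f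
    * id and cancelling gives the formula. *)
Lemma antipode_mulr_skew_primitive (g h x y : H) :
    g \is a GRing.unit -> h \is a GRing.unit ->
    D h = h ⊗ h -> D x = x ⊗ g + h ⊗ x ->
  S (y * x) = - (h^-1 * x * g^-1) * S y.
Proof.
move=> ug uh Dh Dx.
(* The counit axiom at x reads x = eps(x) g + x, and g is invertible. *)
have ex : eps x = 0.
  have := counitl (h := H) x; rewrite Dx linearD /= !counit_tlift_pure.
  rewrite (counit_grouplike uh Dh) scale1r => /(canRL (addrK _)).
  rewrite subrr => /(congr1 ( *%R^~ g^-1))/eqP.
  by rewrite -scalerAl divrr // mul0r scaler_eq0 oner_eq0 orbF => /eqP.
rewrite -antipode_amulrE; apply: convolution_id_inj => {}y.
have := antipodel (h := H) (y * x); rewrite !rmorphM /= ex mulr0 scale0r.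
rewrite Dx mulrDr linearD /= !tlift_mul_pure //.
rewrite (eq_tlift (f := fun a b => S (a * h) * (b * x))
  (g := fun a b => h^-1 * (S a * b) * x)); last first.
  by move=> a b; rewrite antipode_mulr_grouplike // !mulrA.
rewrite -mulr_tlift -mull_tlift antipodel -scalerAr mulr1 -scalerAl.
move=> /(canRL (addrK _)) /(congr1 ( *%R^~ g^-1)).
rewrite mulr_tlift sub0r mulNr -scalerAl -scalerN => <-.
by apply: eq_tlift => a b; rewrite antipode_amulrE mulrA mulrK.
Qed.

End Antipode.

(** * Geometric sums of a root of unity of odd order *)

Section RootOfUnity.
Variables (k : fieldType) (N : nat) (q : k).
Hypotheses (Nodd : odd N) (N_gt1 : (1 < N)%N) (qN : N.-primitive_root q).

Lemma prim_root_neq0 : q != 0.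
Proof.
by rewrite -unitfE -(unitrX_pos _ (ltnW N_gt1)) (prim_expr_order qN) unitr1.
Qed.

Lemma prim_root_expz_eq1 (d : int) : (q ^ d == 1) = (N %| d)%Z.
Proof.
have q0 := prim_root_neq0.
case: d => m; first by rewrite -exprnP -(prim_order_dvd qN).
by rewrite NegzE -invr_expz invr_eq1 -exprnP -(prim_order_dvd qN).
Qed.

Lemma sum_prim_root_expz (d : int) :
  \sum_(i < N) q ^ (d * i%:Z) = if (N %| d)%Z then N%:R else 0.
Proof.
under eq_bigr do rewrite -exprz_exp -exprnP.
case: ifPn => [|Nd].
  rewrite -prim_root_expz_eq1 => /eqP->.
  by under eq_bigr do rewrite expr1n; rewrite sumr_const card_ord.
have := subrX1 (q ^ d) N; rewrite exprnP exprzAC -exprnP (prim_expr_order qN).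
rewrite exp1rz subrr => /esym/eqP; rewrite mulf_eq0 subr_eq0.
by rewrite prim_root_expz_eq1 (negPf Nd) => /eqP.
Qed.

Lemma dvdz_mull2 (d : int) : (N %| 2 * d)%Z = (N %| d)%Z.
Proof. by rewrite Gauss_dvdzr // coprimezE /= coprimen2. Qed.

(** An odd N > 1 does not divide 2. These sums are the coefficients met when E is moved past F^N. *)
Lemma sum_expz_double :
  (\sum_(i < N) q ^ (2 * i%:Z) = 0) * (\sum_(i < N) q ^ (-2 * i%:Z) = 0).
Proof.
have N2 : (N %| 2)%Z = false.
  have := dvdz_mull2 1; rewrite mulr1 => ->.
  by rewrite dvdz1 /=; case: N N_gt1 => [|[|]].
by rewrite !sum_prim_root_expz -[(N %| - 2)%Z]/(N %| 2)%Z N2.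
Qed.

End RootOfUnity.

(** * Commutation formulas, with [h'] in the role of K^-1 *)

Section QuantumRelations.
Variables (k : fieldType) (q : k) (A : algType k) (e f h h' : A).
Variable c : k.
Hypotheses (q0 : q != 0) (hh' : h * h' = 1) (h'h : h' * h = 1).
Hypotheses (he : h * e = q ^+ 2 *: (e * h)) (hf : h * f = q ^- 2 *: (f * h)).
Hypothesis ef : e * f - f * e = c *: (h - h').

Lemma sum_expz_recl (d : int) (m : nat) :
  \sum_(i < m.+1) q ^ (d * i%:Z) = 1 + q ^ d * \sum_(i < m) q ^ (d * i%:Z).
Proof.
rewrite big_ord_recl mulr0 expr0z mulr_sumr; congr (_ + _).
by apply: eq_bigr => i _; rewrite -expfzDr // lift0 intS mulrDr mulr1.
Qed.

Lemma quantum_inv_mulF : h' * f = q ^+ 2 *: (f * h').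
Proof.
rewrite -{1}[f]mulr1 -hh' !mulrA -(mulrA h') -[f * h](scalerKV (a := q ^+ 2)).
  by rewrite -hf; rewrite -!scalerAr mulrA h'h mul1r -scalerAl.
by rewrite expf_neq0.
Qed.

(** Induction on m: moving one more f to the left of h and h' multiplies their coefficients by q^-2
    and q^2, and the new commutator supplies the term 1 of each sum. At m = 0 the truncated [m.-1]
    is harmless because both sums are empty. *)
Lemma quantum_comm_expF (m : nat) : e * f ^+ m = f ^+ m * e + f ^+ m.-1 *
  ((c * \sum_(i < m) q ^ (-2 * i%:Z)) *: h -
   (c * \sum_(i < m) q ^ (2 * i%:Z)) *: h').
Proof.
elim: m => [|m IH].
  by rewrite !big_ord0 !mulr0 !scale0r subr0 !mulr0 addr0 mulr1 mul1r.
rewrite exprSr mulrA IH mulrDl -mulrA (canRL (subrK _) ef) mulrDr mulrA -exprSr.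
rewrite (addrC _ (f ^+ m.+1 * e)) -addrA; congr (_ + _).
rewrite !sum_expz_recl /=.
have -> : forall x y : k, f ^+ m.-1 * ((c * x) *: h - (c * y) *: h') * f =
    f ^+ m.-1 * f * ((c * (q ^ (-2) * x)) *: h - (c * (q ^ 2 * y)) *: h').
  move=> x y; rewrite -[LHS]mulrA -[RHS]mulrA; congr (_ * _).
  rewrite mulrBl mulrBr -!scalerAl -!scalerAr hf quantum_inv_mulF !scalerA.
  congr (_ *: _ - _ *: _).
    by rewrite -[RHS]/(c * (q ^- 2 * x)) mulrAC mulrA.
  by rewrite -[RHS]/(c * (q ^+ 2 * y)) mulrAC mulrA.
rewrite ![c * (1 + _)]mulrDr mulr1 !scalerDl [- (_ *: h' + _)]opprD addrACA.
rewrite -scalerBr [RHS]mulrDr; congr (_ + _).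
case: m {IH} => [|m]; last by rewrite -exprSr.
by rewrite !big_ord0 !mulr0 !scale0r subr0 !mulr0.
Qed.

Lemma quantum_expK_mul (m : nat) : h ^+ m * e = q ^+ (2 * m) *: (e * h ^+ m).
Proof.
elim: m => [|m IH]; first by rewrite muln0 scale1r mulr1 mul1r.
rewrite exprS -mulrA IH -scalerAr (mulrA h e) he.
rewrite -scalerAl scalerA -(mulrA e) -exprS.
by rewrite -exprD mulnS addnC.
Qed.

Lemma quantum_mul_expF (m : nat) : h * f ^+ m = q ^- (2 * m) *: (f ^+ m * h).
Proof.
elim: m => [|m IH]; first by rewrite muln0 invr1 scale1r mulr1 mul1r.
rewrite exprSr mulrA IH -scalerAl -(mulrA _ h) hf.
rewrite -scalerAr scalerA (mulrA _ f) -exprSr.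
by rewrite -invfM -exprD mulnS addnC.
Qed.

End QuantumRelations.

(** * Shift operators on a space of matrices *)

Section MatrixShift.
Variables (k : fieldType) (n : nat).
Local Notation N := n.+1.
Local Notation V := 'M[k]_N.

(** Indices are arbitrary naturals with value 0 out of range, so that shifts truncate by
    themselves. *)
Definition wvec (a b : nat) : V :=
  if (a < N)%N && (b < N)%N then delta_mx (inord a) (inord b) else 0.

Lemma wvec_out a b : ~~ ((a < N)%N && (b < N)%N) -> wvec a b = 0.
Proof. by rewrite /wvec => /negPf->. Qed.

Lemma wvecE a b (i j : 'I_N) : wvec a b i j = ((a == i) && (b == j))%:R.
Proof.
rewrite /wvec; case: ifPn => [/andP[aN bN]|out].
  by rewrite mxE -!val_eqE /= !inordK // ![nat_of_ord _ == _]eq_sym.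
rewrite mxE; case: eqP => // ai; case: eqP => // bj.
by rewrite ai bj !ltn_ord in out.
Qed.

Lemma wvec_ord (i j : 'I_N) : wvec i j = delta_mx i j.
Proof. by rewrite /wvec !ltn_ord !inord_val. Qed.

Lemma wvec_sum (X : V) : X = \sum_i \sum_j X i j *: wvec i j.
Proof.
rewrite {1}[X]matrix_sum_delta; apply: eq_bigr => i _.
by apply: eq_bigr => j _; rewrite wvec_ord.
Qed.

Definition wext (t : nat -> nat -> V) (X : V) : V :=
  \sum_i \sum_j X i j *: t i j.

Lemma wext_is_linear t : linear (wext t).
Proof.
move=> x X Y; rewrite /wext scaler_sumr -big_split; apply: eq_bigr => i _ /=.
rewrite scaler_sumr -big_split; apply: eq_bigr => j _ /=.
by rewrite !mxE scalerDl scalerA.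
Qed.

HB.instance Definition _ t :=
  GRing.isLinear.Build k V V _ (wext t) (wext_is_linear t).

Definition wlin (t : nat -> nat -> V) : 'End(V) := linfun (wext t).

Lemma wlinE t a b :
    (forall a b, ~~ ((a < N)%N && (b < N)%N) -> t a b = 0) ->
  wlin t (wvec a b) = t a b.
Proof.
move=> t0; rewrite lfunE /= /wext.
have [/andP[aN bN]|out] := boolP ((a < N)%N && (b < N)%N); last first.
  rewrite wvec_out // t0 // big1 // => i _; rewrite big1 // => j _.
  by rewrite mxE scale0r.
rewrite (bigD1 (Ordinal aN)) //= (bigD1 (Ordinal bN)) //= wvecE !eqxx scale1r.
rewrite !big1 ?addr0 // => [i ia|j jb].
  rewrite big1 // => j _; rewrite wvecE.
  by rewrite (negPf (_ : a != i)) ?scale0r // eq_sym.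
by rewrite wvecE (negPf (_ : b != j)) ?andbF ?scale0r // eq_sym.
Qed.

Lemma lfun_wvecP (f g : 'End(V)) :
  (forall a b, (a < N)%N -> (b < N)%N -> f (wvec a b) = g (wvec a b)) -> f = g.
Proof.
move=> fg; apply/lfunP => X; rewrite (wvec_sum X) !linear_sum.
apply: eq_bigr => i _; rewrite !linear_sum; apply: eq_bigr => j _.
by rewrite !linearZ /= fg.
Qed.

End MatrixShift.

(** * The blocks of the right regular representation *)

Section RegularRepresentation.
Variables (k : fieldType) (n : nat) (q : k) (j : int).
Local Notation N := n.+1.
Hypotheses (Nodd : odd N) (N_gt1 : (1 < N)%N) (qN : N.-primitive_root q).
Local Notation w := (wvec k n).
Local Notation A := 'End('M[k]_N).

Let q0 : q != 0 := prim_root_neq0 N_gt1 qN.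

Definition wt (a b : nat) : k := q ^ (j + 2 * a%:Z - 2 * b%:Z).

Lemma wt_neq0 a b : wt a b != 0. Proof. exact: expfz_neq0. Qed.

Lemma wtSr a b : wt a b = q ^+ 2 * wt a b.+1.
Proof. by rewrite /wt [q ^+ 2]exprnP -expfzDr //; congr (_ ^ _); ring. Qed.

Lemma wtSl a b : wt a.+1 b = q ^+ 2 * wt a b.
Proof. by rewrite /wt [q ^+ 2]exprnP -expfzDr //; congr (_ ^ _); ring. Qed.

Lemma wtXN a b : wt a b ^+ N = 1.
Proof.
by rewrite /wt exprnP exprzAC -exprnP (prim_expr_order qN) exp1rz.
Qed.

Lemma wtXn a b : wt a b ^+ n = (wt a b)^-1.
Proof.
by apply: (mulfI (wt_neq0 a b)); rewrite -exprS wtXN divff // wt_neq0.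
Qed.

(** This comes from E^b F = F E^b + sum over i < b of E^i [E,F] E^(b-1-i), where K - K^-1 acts on
    w_(a,i) by [wt a i - (wt a i)^-1]. *)
Definition regF_coef (a b : nat) : k :=
  (q - q^-1)^-1 * \sum_(i < b) (wt a i - (wt a i)^-1).

Lemma regF_coef0 a : regF_coef a 0 = 0.
Proof. by rewrite /regF_coef big_ord0 mulr0. Qed.

Lemma regF_coefS a b :
  regF_coef a b.+1 = regF_coef a b + (q - q^-1)^-1 * (wt a b - (wt a b)^-1).
Proof. by rewrite /regF_coef big_ord_recr mulrDr. Qed.

(** This makes [regF] consistent with w_(a,N) = 0: the index b = N is out of range, but [b.-1] is
    not. *)
Lemma regF_coefN a : regF_coef a N = 0.
Proof.
rewrite /regF_coef sumrB.
have -> : \sum_(i < N) wt a i = wt a 0 * \sum_(i < N) q ^ (-2 * i%:Z).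
  rewrite mulr_sumr; apply: eq_bigr => i _; rewrite /wt -expfzDr //.
  by congr (_ ^ _); ring.
have -> : \sum_(i < N) (wt a i)^-1 = (wt a 0)^-1 * \sum_(i < N) q ^ (2 * i%:Z).
  rewrite mulr_sumr; apply: eq_bigr => i _; rewrite /wt !invr_expz -expfzDr //.
  by congr (_ ^ _); ring.
by rewrite !(sum_expz_double Nodd N_gt1 qN) !mulr0 subr0 mulr0.
Qed.

(* FalgLfun multiplies endomorphisms in reverse order, (f * g) u = g (f u), so
   these are right multiplications. *)
Definition regE : A := wlin (fun a b => w a b.+1).
Definition regK : A := wlin (fun a b => wt a b *: w a b).
Definition regF : A := wlin (fun a b => w a.+1 b + regF_coef a b *: w a b.-1).

Lemma regE_w a b : regE (w a b) = w a b.+1.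
Proof.
apply: wlinE => {}a {}b out; apply: wvec_out; apply: contra out.
by case/andP=> -> /ltnW.
Qed.

Lemma regK_w a b : regK (w a b) = wt a b *: w a b.
Proof. by apply: wlinE => {}a {}b out; rewrite wvec_out ?scaler0. Qed.

Lemma regF_w a b : regF (w a b) = w a.+1 b + regF_coef a b *: w a b.-1.
Proof.
apply: (wlinE (t := fun a b => w a.+1 b + regF_coef a b *: w a b.-1)).
move=> {}a {}b out.
rewrite wvec_out ?add0r; last by apply: contra out => /andP[/ltnW-> ->].
have [->|bN] := eqVneq b N; first by rewrite regF_coefN scale0r.
rewrite wvec_out ?scaler0 //; apply: contra out => /andP[-> /=].
by case: b bN => // b; rewrite eqSS /= => bn bN; rewrite ltnS ltn_neqAle bn.
Qed.

Lemma regEX_w m a b : (regE ^+ m) (w a b) = w a (b + m).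
Proof.
elim: m b => [|m IH] b; first by rewrite addn0 id_lfunE.
by rewrite exprS lfun_mulE regE_w IH addSnnS.
Qed.

Lemma regKX_w m a b : (regK ^+ m) (w a b) = wt a b ^+ m *: w a b.
Proof.
elim: m => [|m IH]; first by rewrite scale1r id_lfunE.
by rewrite exprSr lfun_mulE IH linearZ /= regK_w scalerA exprSr.
Qed.

Lemma regFX_w m a : (regF ^+ m) (w a 0) = w (a + m) 0.
Proof.
elim: m a => [|m IH] a; first by rewrite addn0 id_lfunE.
by rewrite exprS lfun_mulE regF_w regF_coef0 scale0r addr0 IH addSnnS.
Qed.

Lemma regK_unip : regK ^+ N = 1.
Proof.
by apply: lfun_wvecP => a b _ _; rewrite regKX_w wtXN scale1r id_lfunE.
Qed.

Lemma regKE : regK * regE = q ^+ 2 *: (regE * regK).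
Proof.
apply: lfun_wvecP => a b _ _; rewrite scale_lfunE !lfun_mulE regK_w linearZ /=.
by rewrite !regE_w regK_w scalerA -wtSr.
Qed.

Lemma regKF : regK * regF = q ^- 2 *: (regF * regK).
Proof.
apply: lfun_wvecP => a b _ _; rewrite scale_lfunE !lfun_mulE regK_w linearZ /=.
rewrite !regF_w [regK _]linearD /= [regK (_ *: _)]linearZ /= !regK_w.
rewrite !scalerDr !scalerA.
rewrite wtSl mulKf ?expf_neq0 //; congr (_ + _ *: _).
case: b => [|b]; first by rewrite regF_coef0 !(mulr0, mul0r).
rewrite /= (wtSr a b) -[RHS]mulrA (mulrCA _ (q ^+ 2)).
by rewrite mulKf ?expf_neq0 // mulrC.
Qed.

Lemma regEF :
  regE * regF - regF * regE = (q - q^-1)^-1 *: (regK - regK ^+ n).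
Proof.
apply: lfun_wvecP => a b _ _; rewrite scale_lfunE !add_lfunE !opp_lfunE.
rewrite !lfun_mulE regE_w !regF_w.
rewrite [regE _]linearD /= [regE (_ *: _)]linearZ /= !regE_w.
rewrite regK_w regKX_w wtXn -scalerBl scalerA regF_coefS.
(* At b = 0 the two vectors differ, but the coefficient vanishes. *)
have -> : regF_coef a b *: w a b.-1.+1 = regF_coef a b *: w a b.
  by case: b => // ; rewrite regF_coef0 !scale0r.
by rewrite opprD addrACA subrr add0r scalerDl /= addrAC subrr add0r.
Qed.

(** E commutes with F^N, since the sums in the commutator vanish. As w_ab = w_a0 E^b, it remains to
    see that F^N kills w_a0, which it shifts out of range. *)
Lemma regF_nilp : regF ^+ N = 0.
Proof.
have EF : regE * regF ^+ N = regF ^+ N * regE.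
  rewrite (quantum_comm_expF q0 (h := regK) (h' := regK ^+ n)
    (c := (q - q^-1)^-1)) ?regKF ?regEF -?exprS -?exprSr ?regK_unip //.
  rewrite !(sum_expz_double Nodd N_gt1 qN).
  by rewrite ?mulr0 ?scale0r ?subr0 ?mulr0 ?addr0.
apply: lfun_wvecP => a b _ _; rewrite -[b]add0n -regEX_w -lfun_mulE.
have /commrX <- : GRing.comm (regF ^+ N) regE by exact: esym.
rewrite lfun_mulE regFX_w wvec_out ?linear0 ?lfunE //.
by rewrite negb_and -!leqNgt leq_addl.
Qed.

Lemma reg_rels : uqsl2_rels N q regE regF regK.
Proof.
split; [|exact: regF_nilp|exact: regK_unip|exact: regKE|exact: regKF|].
  apply: lfun_wvecP => a b _ _; rewrite regEX_w wvec_out ?lfunE //.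
  by rewrite negb_and -!leqNgt leq_addl orbT.
by rewrite subSS subn0 regEF.
Qed.

Lemma reg_monomial a c b :
  (regF ^+ a * regK ^+ c * regE ^+ b) (w 0 0) = wt a 0 ^+ c *: w a b.
Proof.
by rewrite !lfun_mulE regFX_w add0n regKX_w linearZ /= regEX_w.
Qed.

End RegularRepresentation.

(** * Leading terms of the antipode words *)

Section LowerPart.
Variables (k : fieldType) (n : nat).
Local Notation N := n.+1.
Local Notation V := 'M[k]_N.

(** A filtration by the second index, stable under F and K; its members have no coefficient on
    w_(a,b). *)
Definition columns_lt (b : nat) (X : V) :=
  forall (i l : 'I_N), (b <= l)%N -> X i l = 0.

Lemma columns_ltD b X Y :
  columns_lt b X -> columns_lt b Y -> columns_lt b (X + Y).
Proof. by move=> X0 Y0 i l bl; rewrite mxE X0 ?Y0 ?addr0. Qed.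

Lemma columns_ltZ b x X : columns_lt b X -> columns_lt b (x *: X).
Proof. by move=> X0 i l bl; rewrite mxE X0 ?mulr0. Qed.

Lemma columns_lt_wvec b a c : (c < b)%N -> columns_lt b (wvec k n a c).
Proof.
by move=> cb i l bl; rewrite wvecE (ltn_eqF (leq_trans cb bl)) andbF.
Qed.

Lemma columns_lt_wlin b t X :
    (forall a c, (c < b)%N -> columns_lt b (t a c)) ->
  columns_lt b X -> columns_lt b (wlin t X).
Proof.
move=> t0 X0 i l bl; rewrite lfunE summxE big1 // => a _.
rewrite summxE big1 // => c _; rewrite mxE.
have [cb|bc] := ltnP c b; first by rewrite t0 ?mulr0.
by rewrite X0 ?mul0r.
Qed.

End LowerPart.

Section RegularAntipode.
Variables (k : fieldType) (n : nat) (q : k) (j : int).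
Local Notation N := n.+1.
Hypotheses (Nodd : odd N) (N_gt1 : (1 < N)%N) (qN : N.-primitive_root q).
Local Notation w := (wvec k n).
Local Notation rE := (regE k n).
Local Notation rK := (regK n q j).
Local Notation rF := (regF n q j).

Let q0 : q != 0 := prim_root_neq0 N_gt1 qN.

Lemma columns_lt_regF b a c :
  (c < b)%N -> columns_lt b (w a.+1 c + regF_coef q j a c *: w a c.-1).
Proof.
move=> cb; apply: columns_ltD; first exact: columns_lt_wvec.
by apply/columns_ltZ/columns_lt_wvec/(leq_ltn_trans (leq_pred _)).
Qed.

Lemma columns_lt_regFK b X : columns_lt b X -> columns_lt b ((rF * rK) X).
Proof.
move=> X0; rewrite lfun_mulE; apply: columns_lt_wlin => [a c cb|].
  exact/columns_ltZ/columns_lt_wvec.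
apply: columns_lt_wlin X0 => a c; exact: columns_lt_regF.
Qed.

(** Step i contributes (wt 0 i)^-1 = q^(2i-j), and the 2i with i < m add up to m(m-1). *)
Lemma regKE_expn_w m : ((rK ^+ n * rE) ^+ m) (w 0 0) =
  q ^ (m%:Z * (m%:Z - 1) - j * m%:Z) *: w 0 m.
Proof.
elim: m => [|m IH]; first by rewrite mulr0 mul0r subr0 scale1r id_lfunE.
rewrite exprSr lfun_mulE IH linearZ /= lfun_mulE regKX_w (wtXn j N_gt1 qN).
rewrite linearZ /= regE_w scalerA /wt invr_expz -expfzDr //.
by congr (_ ^ _ *: _); rewrite intS; ring.
Qed.

(** Step i contributes wt (i+1) b = q^(j+2(i+1)-2b) to the leading term; the lowering part of F goes
    into the remainder. *)
Lemma regFK_expn_w m b : exists2 R, columns_lt b R &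
  ((rF * rK) ^+ m) (w 0 b) =
    q ^ (m%:Z * (m%:Z + 1) + j * m%:Z - 2 * b%:Z * m%:Z) *: w m b + R.
Proof.
elim: m => [|m [R R0 IH]].
  exists 0; first by move=> i l _; rewrite mxE.
  by rewrite !(mulr0, mul0r) addr0 subr0 addr0 scale1r id_lfunE.
pose s := q ^ (m%:Z * (m%:Z + 1) + j * m%:Z - 2 * b%:Z * m%:Z).
exists (s *: rK (regF_coef q j m b *: w m b.-1) + (rF * rK) R).
  apply: columns_ltD (columns_lt_regFK R0); apply: columns_ltZ.
  case: b {s R R0 IH} => [|b].
    by rewrite regF_coef0 scale0r linear0 => i l _; rewrite mxE.
  rewrite linearZ /= regK_w; do 2!apply: columns_ltZ.
  exact: columns_lt_wvec.
rewrite exprSr lfun_mulE IH -/s linearD addrA; congr (_ + _).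
rewrite linearZ /= lfun_mulE regF_w // linearD scalerDr /=; congr (_ + _).
rewrite regK_w scalerA /s /wt -expfzDr //.
by congr (_ ^ _ *: _); rewrite intS; ring.
Qed.

(** Only the leading term reaches column b, so the coefficient is the product of the scalars of the
    three factors. *)
Lemma reg_antipode_coef (a b : 'I_N) (c : nat) :
  ((rK ^+ n * rE) ^+ b * (rK ^+ n) ^+ c * (rF * rK) ^+ a) (w 0 0) a b =
  q ^ ((a%:Z - b%:Z) * (a%:Z - b%:Z + 1) + j * (a%:Z - b%:Z - c%:Z)
       + 2 * b%:Z * c%:Z).
Proof.
rewrite !lfun_mulE regKE_expn_w linearZ /= -exprM mulnC exprM.
have -> : (rK ^+ c ^+ n) (w 0 b) = q ^ (- c%:Z * (j - 2 * b%:Z)) *: w 0 b.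
  rewrite -exprM regKX_w exprM exprAC (wtXn j N_gt1 qN).
  rewrite /wt invr_expz exprnP exprz_exp; congr (_ ^ _ *: _); ring.
have [R R0 RE] := regFK_expn_w a b.
rewrite scalerA linearZ /= RE mxE mxE mxE wvecE !eqxx R0 //= addr0 mulr1.
by rewrite -!expfzDr //; congr (_ ^ _); ring.
Qed.

End RegularAntipode.

(** * Spanning by the monomials F^a K^c E^b *)

Section Generation.
Variables (k : fieldType) (U : falgType k).

Lemma span_prodv_sub (X Y : seq U) (W : {vspace U}) :
  {in X & Y, forall x y, x * y \in W} -> (<<X>> * <<Y>> <= W)%VS.
Proof.
move=> XY; apply/prodvP => u v uX vY.
rewrite (coord_span (X := in_tuple X) uX) (coord_span (X := in_tuple Y) vY).
rewrite mulr_suml memv_suml // => i _; rewrite mulr_sumr memv_suml // => l _.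
by rewrite -scalerAl -scalerAr !rpredZ // XY // mem_nth // size_tuple.
Qed.

Variables (N : nat) (q : k) (E F K : U).
Hypothesis pres : uqsl2_presentation N q E F K.

(** The universal property maps U to the subalgebra generated by E, F, K. Followed by the inclusion,
    this fixes the generators, so by uniqueness it is the identity. *)
Lemma uqsl2_generated (x : U) : x \in agenv <<[:: E; F; K]>>.
Proof.
have [rels univ] := pres.
pose G := agenv_aspace <<[:: E; F; K]>>.
have G1 : 1 \in G by rewrite memvE sub1_agenv.
have Ggen y : y \in [:: E; F; K] -> y \in G.
  by move=> yX; apply: (subvP (sub_agenv _)); apply: memv_span.
have iota_monoid : monoid_morphism (vsval : subvs_of G -> U).
  by split=> //; apply/eqP; rewrite algid_eq1.
have iota_linear : linear (vsval : subvs_of G -> U) by [].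
pose iota : {lrmorphism subvs_of G -> U} := HB.pack (vsval : subvs_of G -> U)
  (GRing.isLinear.Build k (subvs_of G) U _ vsval iota_linear)
  (GRing.isMonoidMorphism.Build (subvs_of G) U vsval iota_monoid).
pose gen y yX : subvs_of G := Subvs (Ggen y yX).
have [EX FX KX] :
    [/\ E \in [:: E; F; K], F \in [:: E; F; K] & K \in [:: E; F; K]].
  by rewrite !inE !eqxx !orbT.
have iota_inj : injective iota by exact: val_inj.
have relsG : uqsl2_rels N q (gen E EX) (gen F FX) (gen K KX).
  case: rels => EN FN KN KE KF EF.
  split; apply: iota_inj.
  - by rewrite rmorphXn rmorph0.
  - by rewrite rmorphXn rmorph0.
  - by rewrite rmorphXn rmorph1.
  - by rewrite linearZ !rmorphM.
  - by rewrite linearZ !rmorphM.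
  - by rewrite linearZ !rmorphB !rmorphM rmorphXn.
have [phi [[phiE phiF phiK] _]] := univ _ _ _ _ relsG.
have [phi0 [_ uniq0]] := univ _ _ _ _ rels.
have /= <- : iota (phi x) = x.
  transitivity (phi0 x); last by rewrite -(uniq0 idfun).
  by apply: (uniq0 (iota \o phi)); rewrite /= phiE phiF phiK.
exact: subvsP.
Qed.

End Generation.

Section Spanning.
Variables (k : fieldType) (U : falgType k) (n : nat) (q : k) (E F K : U).
Local Notation N := n.+1.
Hypotheses (q0 : q != 0) (pres : uqsl2_presentation N q E F K).

Definition pbw (i : 'I_N * 'I_N * 'I_N) : U :=
  F ^+ i.1.1 * K ^+ i.1.2 * E ^+ i.2.

Let W := <<[seq pbw i | i : 'I_N * 'I_N * 'I_N]>>%VS.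

(** Unbounded exponents are allowed: nilpotency kills large powers of E and F, and those of K reduce
    modulo N. *)
Lemma monomial_mem_span a c b : F ^+ a * K ^+ c * E ^+ b \in W.
Proof.
have [[EN FN KN _ _ _] _] := pres.
have nilp (x : U) m : x ^+ N = 0 -> ~~ (m < N)%N -> x ^+ m = 0.
  by rewrite -leqNgt => xN /subnK <-; rewrite exprD xN mulr0.
have [aN|/(nilp _ _ FN)->] := boolP (a < N)%N; last by rewrite !mul0r mem0v.
have [bN|/(nilp _ _ EN)->] := boolP (b < N)%N; last by rewrite mulr0 mem0v.
rewrite -(expr_mod c KN); apply: memv_span; apply/imageP.
have cN : (c %% N < N)%N by rewrite ltn_mod.
by exists (Ordinal aN, Ordinal cN, Ordinal bN).
Qed.

Lemma pbw_span (x : U) : x \in W.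
Proof.
have [[_ _ KN KE KF EF] _] := pres.
have KK' : K * K ^+ n = 1 by rewrite -exprS.
have K'K : K ^+ n * K = 1 by rewrite -exprSr.
have EF' : E * F - F * E = (q - q^-1)^-1 *: (K - K ^+ n).
  by rewrite EF subSS subn0.
(* It suffices that the span contains 1 and is stable under left multiplication by the
   generators. *)
apply: (subvP _ _ (uqsl2_generated pres x)); apply: agenv_sub_modl.
  by rewrite -memvE -[1]mulr1 -{1}[1]mulr1 (monomial_mem_span 0 0 0).
apply: span_prodv_sub => y z; rewrite !inE => yX /imageP[[[a c] b] _ ->] {z}.
rewrite /pbw /=; case/or3P: yX => /eqP->.
(* E is moved past F^a and K^c; the correction [s] yields monomials with K^(c+1) and K^(n+c). *)
- rewrite !mulrA (quantum_comm_expF q0 KK' K'K KF EF').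
  set s := _ *: K - _.
  have -> : (F ^+ a * E + F ^+ a.-1 * s) * K ^+ c * E ^+ b =
      q ^- (2 * c) *: (F ^+ a * K ^+ c * E ^+ b.+1) +
      F ^+ a.-1 * s * K ^+ c * E ^+ b.
    rewrite !mulrDl; congr (_ + _); rewrite -(mulrA (F ^+ a) E).
    rewrite -[E * K ^+ c](scalerK (a := q ^+ (2 * c))) ?expf_neq0 //.
    rewrite -(quantum_expK_mul KE) -scalerAr -scalerAl !mulrA exprS.
    by rewrite mulrA.
  rewrite rpredD ?rpredZ ?monomial_mem_span // /s mulrBr !mulrBl -!scalerAr.
  rewrite -!scalerAl -!(mulrA (F ^+ _)) -exprS -exprD !mulrA.
  by rewrite rpredB ?rpredZ ?monomial_mem_span.
- by rewrite !mulrA -exprS monomial_mem_span.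
- rewrite !mulrA (quantum_mul_expF KF) -!scalerAl -(mulrA (F ^+ a)) -exprS.
  by rewrite rpredZ ?monomial_mem_span.
Qed.

End Spanning.

(** * Character sums modulo N *)

Section RootSums.
Variables (k : fieldType) (N : nat) (q : k).
Hypotheses (Nodd : odd N) (N_gt1 : (1 < N)%N) (qN : N.-primitive_root q).

Let q0 : q != 0 := prim_root_neq0 N_gt1 qN.

(** Exactly one i < N, the residue of -d, makes i + d divisible by N. *)
Lemma sum_ord_dvdz_shift (G : int -> k) (d : int) :
    (forall m, (N %| m)%Z -> G m = 1) ->
  \sum_(i < N) (if (N %| i%:Z + d)%Z then G (i%:Z + d) else 0) = 1.
Proof.
move=> G1; pose i0 := `|((- d) %% N)%Z|%N.
have N0 : N%:Z != 0 by rewrite eqz_nat -lt0n ltnW.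
have i0E : i0%:Z = ((- d) %% N)%Z by rewrite /i0 gez0_abs ?modz_ge0.
have i0N : (i0 < N)%N by rewrite -ltz_nat i0E -[N%:Z]gez0_abs ?ltz_mod.
have dvdE (i : nat) : (N %| i%:Z + d)%Z = (i == i0 %[mod N]).
  by rewrite -eqz_nat -!modz_nat -[d in LHS]opprK -eqz_mod_dvd i0E modz_mod.
rewrite (bigD1 (Ordinal i0N)) //= dvdE eqxx G1 ?dvdE ?eqxx //.
rewrite big1 ?addr0 // => i ii0; rewrite dvdE !modn_small //.
by rewrite (negPf (_ : i != i0 :> nat)).
Qed.

Lemma sum_dual_weights (x c c' : nat) : (c < N)%N -> (c' < N)%N ->
  N%:R^-1 * \sum_(j < N) q ^ ((j%:Z + x%:Z) * (c'%:Z - c%:Z)) = (c' == c)%:R.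
Proof.
move=> cN c'N.
have -> : \sum_(j < N) q ^ ((j%:Z + x%:Z) * (c'%:Z - c%:Z)) =
    q ^ (x%:Z * (c'%:Z - c%:Z)) * \sum_(j < N) q ^ ((c'%:Z - c%:Z) * j%:Z).
  rewrite mulr_sumr; apply: eq_bigr => j _; rewrite -expfzDr //.
  by congr (_ ^ _); ring.
rewrite (sum_prim_root_expz N_gt1 qN) -eqz_mod_dvd !modz_nat.
rewrite eqz_nat !modn_small //; have [->|_] := eqVneq; last by rewrite !mulr0.
by rewrite subrr mulr0 expr0z mul1r mulVf ?(prim_root_natf_neq0 qN).
Qed.

(** The sums are exchanged: since 2 is invertible modulo N, the sum over c is N times the indicator
    of N | j + d. The single surviving j has weight q^((j+d)d) = 1. *)
Lemma sum_trace_weights (d : int) :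
  \sum_(c < N) (N%:R^-1 * \sum_(j < N) q ^ ((j%:Z + d) * (d - 2 * c%:Z))) = 1.
Proof.
have N0 := prim_root_natf_neq0 qN.
rewrite -mulr_sumr exchange_big /=.
have sumE (j : 'I_N) : \sum_(c < N) q ^ ((j%:Z + d) * (d - 2 * c%:Z)) =
    N%:R * (if (N %| j%:Z + d)%Z then q ^ ((j%:Z + d) * d) else 0).
  have -> : \sum_(c < N) q ^ ((j%:Z + d) * (d - 2 * c%:Z)) =
      q ^ ((j%:Z + d) * d) * \sum_(c < N) q ^ (2 * (- (j%:Z + d)) * c%:Z).
    rewrite mulr_sumr; apply: eq_bigr => c _; rewrite -expfzDr //.
    by congr (_ ^ _); ring.
  rewrite (sum_prim_root_expz N_gt1 qN) (dvdz_mull2 Nodd) dvdzE abszN -dvdzE.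
  by case: ifP => _; rewrite ?mulr0 // mulrC.
under eq_bigr do rewrite sumE.
rewrite -mulr_sumr mulKf //.
apply: (sum_ord_dvdz_shift (G := fun m => q ^ (m * d))) => m Nm.
by apply/eqP; rewrite (prim_root_expz_eq1 N_gt1 qN) dvdz_mulr.
Qed.

(** A geometric sum of ratio -x, where (-x)^N = -1 because N is odd. *)
Lemma sum_opp_root (x : k) :
  x ^+ N = 1 -> (1 + x) * \sum_(i < N) (- x) ^+ i = 2.
Proof.
move=> xN; have := subrX1 (- x) N.
rewrite exprNn xN mulr1 -signr_odd Nodd expr1.
by rewrite -opprD -[- x - 1]opprD mulNr (addrC x) => /oppr_inj <-.
Qed.

End RootSums.

(** * The antipode on monomials *)

Section AntipodeMonomial.
Variables (k : fieldType) (H : hopfAlg k).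
Local Notation S := (antipode H).

Lemma antipode_mulrX (x g : H) : (forall y, S (y * x) = g * S y) ->
  forall y m, S (y * x ^+ m) = g ^+ m * S y.
Proof.
move=> Sx y m; elim: m => [|m IH]; first by rewrite mulr1 mul1r.
by rewrite exprSr mulrA Sx IH mulrA -exprS.
Qed.

Variables (n : nat) (q : k) (E F K : H).
Hypothesis HU : is_uqsl2 n.+1 q E F K.

Lemma antipode_monomial a c b : S (F ^+ a * K ^+ c * E ^+ b) =
  (-1) ^+ (a + b) *: ((K ^+ n * E) ^+ b * (K ^+ n) ^+ c * (F * K) ^+ a).
Proof.
case: HU => [[[_ _ KN _ _ _] _] DE DF DK].
have KK' : K * K ^+ n = 1 by rewrite -exprS.
have K'K : K ^+ n * K = 1 by rewrite -exprSr.
have uK : K \is a GRing.unit by apply/unitrP; exists (K ^+ n).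
have KV : K^-1 = K ^+ n by rewrite -[RHS]mulr1 -(divrr uK) mulrA K'K mul1r.
have D1 : comult H 1 = 1 ⊗ 1 by rewrite rmorph1.
(* In the skew-primitive formula, (g, h) is (1, K) for E and (K^-1, 1) for F. *)
have SE y := antipode_mulr_skew_primitive y (unitr1 H) uK DK DE.
have SF y : S (y * F) = - (F * K) * S y.
  rewrite (antipode_mulr_skew_primitive (g := K^-1) (h := 1))
    ?unitrV ?unitr1 //.
  by rewrite invr1 mul1r invrK.
have SK y := antipode_mulr_grouplike y uK DK.
(* Factors are peeled off from the right; writing F^a as 1 F^a leaves S(1) at the end. *)
rewrite (antipode_mulrX SE) (antipode_mulrX SK) -[F ^+ a]mul1r.
rewrite (antipode_mulrX SF) antipode1 mulr1 invr1 mulr1 KV.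
have XN (x : H) m : (- x) ^+ m = (-1) ^+ m *: x ^+ m.
  by rewrite -scaleN1r exprZn.
by rewrite !XN -!scalerAl -!scalerAr scalerA -exprD addnC mulrA.
Qed.

End AntipodeMonomial.

(** * Coordinates and the trace *)

Section TraceOfAntipode.
Variables (k : fieldType) (n : nat) (q : k) (H : hopfAlg k) (E F K : H).
Local Notation N := n.+1.
Hypotheses (Nodd : odd N) (N_gt1 : (1 < N)%N) (qN : N.-primitive_root q).
Hypothesis HU : is_uqsl2 N q E F K.

Let q0 : q != 0 := prim_root_neq0 N_gt1 qN.

Section Coordinates.
Variable phi : 'I_N -> {lrmorphism H -> 'End('M[k]_N)}.
Hypothesis phiE : forall j, [/\ phi j E = regE k n, phi j F = regF n q j
  & phi j K = regK n q j].

(* Coordinates on the monomials F^a K^c E^b: phi_j maps them to multiples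
   q^((j + 2a) c) of the basis vector (a, b), and the exponent c is recovered
   by Fourier inversion over j. *)
Definition pbw_coord (i : 'I_N * 'I_N * 'I_N) (x : H) : k :=
  N%:R^-1 * \sum_(j < N) q ^ (- i.1.2%:Z * (j%:Z + 2 * i.1.1%:Z)) *
    (phi j x) (wvec k n 0 0) i.1.1 i.2.

Lemma pbw_coord_scalar i : scalar (pbw_coord i).
Proof.
move=> r x y; rewrite /pbw_coord mulrCA -mulrDr; congr (_ * _).
rewrite mulr_sumr -big_split; apply: eq_bigr => j _ /=.
by rewrite linearP add_lfunE scale_lfunE !mxE mulrDr mulrCA.
Qed.

Lemma pbw_coord_pbw i i' : pbw_coord i (pbw E F K i') = (i' == i)%:R.
Proof.
case: i i' => [[a c] b] [[a' c'] b']; rewrite /pbw_coord /pbw /=.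
rewrite -[RHS]/((a' == a) && (c' == c) && (b' == b))%:R.
have coef (j : 'I_N) : (phi j (F ^+ a' * K ^+ c' * E ^+ b')) (wvec k n 0 0) a b
    = q ^ ((j%:Z + 2 * a'%:Z) * c'%:Z) * ((a' == a) && (b' == b))%:R.
  have [eE eF eK] := phiE j.
  rewrite !rmorphM !rmorphXn /= eE eF eK reg_monomial // mxE wvecE /wt.
  by rewrite exprnP exprz_exp mulr0 subr0.
under eq_bigr => j _ do rewrite coef mulrA -expfzDr //.
rewrite -mulr_suml mulrA; have [->|] := eqVneq a' a; last by rewrite mulr0.
case: (b' == b); last by rewrite !andbF mulr0.
rewrite mulr1 !andbT.
rewrite -(sum_dual_weights N_gt1 qN (2 * a) (ltn_ord c) (ltn_ord c')).
congr (_ * _); apply: eq_bigr => j _; congr (_ ^ _); rewrite PoszM; ring.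
Qed.

Lemma pbw_coord_expansion x : x = \sum_i pbw_coord i x *: pbw E F K i.
Proof.
pose g y := \sum_i pbw_coord i y *: pbw E F K i.
have g_linear : linear g.
  move=> r y z; rewrite /g scaler_sumr -big_split; apply: eq_bigr => i _.
  by rewrite pbw_coord_scalar scalerDl scalerA.
pose gL : {linear H -> H} :=
  HB.pack g (GRing.isLinear.Build k H H _ g g_linear).
(* The identity and [g] agree on the monomials, hence on their span, which is all of [H]. *)
suff /subvP/(_ x (pbw_span q0 (uqsl2_pres HU) x)) :
    (<<[seq pbw E F K i | i : 'I_N * 'I_N * 'I_N]>> <=
      lker (\1%VF - linfun gL))%VS.
  rewrite memv_ker add_lfunE opp_lfunE id_lfunE lfunE subr_eq0 => /eqP.
  exact.
apply/span_subvP => _ /imageP[i _ ->].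
rewrite memv_ker add_lfunE opp_lfunE id_lfunE lfunE subr_eq0 /= /g.
rewrite (bigD1 i) //= pbw_coord_pbw eqxx scale1r big1 ?addr0 // => l li.
by rewrite pbw_coord_pbw eq_sym (negPf li) scale0r.
Qed.

(** With d = a - b, the exponents from [pbw_coord] and [reg_antipode_coef] add up to d + (j + d)(d -
    2c), the shape summed by [sum_trace_weights]. *)
Lemma pbw_coord_antipode (a b c : 'I_N) :
  pbw_coord (a, c, b) (antipode H (pbw E F K (a, c, b))) =
  (-1) ^+ (a + b) * q ^ (a%:Z - b%:Z) * (N%:R^-1 * \sum_(j < N)
     q ^ ((j%:Z + (a%:Z - b%:Z)) * (a%:Z - b%:Z - 2 * c%:Z))).
Proof.
rewrite /pbw_coord /pbw /= (antipode_monomial HU) [RHS]mulrCA; congr (_ * _).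
rewrite mulr_sumr; apply: eq_bigr => j _.
have [eE eF eK] := phiE j.
rewrite linearZ /= !(rmorphM, rmorphXn) /= eE eF eK scale_lfunE mxE.
rewrite reg_antipode_coef // mulrCA -!mulrA -!expfzDr //.
by congr (_ * _ ^ _); ring.
Qed.

End Coordinates.

Lemma trace_antipode_sum :
  nu2 H = (\sum_(i < N) (- q) ^+ i) * (\sum_(i < N) (- q^-1) ^+ i).
Proof.
have [[_ univ] _ _ _] := HU.
have /fin_all_exists[phi phiP] (j : 'I_N) :
    exists phi : {lrmorphism H -> 'End('M[k]_N)},
      [/\ phi E = regE k n, phi F = regF n q j & phi K = regK n q j].
  by have [phi []] := univ _ _ _ _ (reg_rels j Nodd N_gt1 qN); exists phi.
rewrite /nu2 (lfun_trace_expansion _ (pbw_coord_scalar phi)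
  (pbw_coord_expansion phiP)).
pose T (a c b : 'I_N) := (-1) ^+ (a + b) * q ^ (a%:Z - b%:Z) *
  (N%:R^-1 *
     \sum_(j < N) q ^ ((j%:Z + (a%:Z - b%:Z)) * (a%:Z - b%:Z - 2 * c%:Z))).
transitivity (\sum_i T i.1.1 i.1.2 i.2).
  by apply: eq_bigr => [[[a c] b]] _; rewrite (pbw_coord_antipode phiP).
rewrite -(pair_bigA _ (fun ac b => T ac.1 ac.2 b)) /=.
rewrite -(pair_bigA _ (fun a c => \sum_b T a c b)) /=.
rewrite mulr_suml; apply: eq_bigr => a _; rewrite mulr_sumr exchange_big /=.
apply: eq_bigr => b _.
(* For fixed a and b the sum over c is 1, and the remaining weight splits into a factor in a and one
   in b. *)
rewrite -mulr_sumr (sum_trace_weights Nodd N_gt1 qN) mulr1.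
rewrite expfzDr // -invr_expz -!exprnP -exprVn exprD (exprNn q) (exprNn q^-1).
exact: mulrACA.
Qed.

End TraceOfAntipode.

Theorem mainTheorem11 (k : closedFieldType) (N : nat) (q : k)
    (U : hopfAlg k) (E F K : U) :
  [pchar k] =i pred0 ->
  odd N -> (1 < N)%N -> N.-primitive_root q ->
  is_uqsl2 N q E F K ->
  nu2 U = 4 / ((1 + q) * (1 + q^-1)).
Proof.
case: N => // n /pcharf0P char0 Nodd N_gt1 qN HU.
rewrite (trace_antipode_sum Nodd N_gt1 qN HU).
have n2 : (2 : k) != 0 by rewrite char0.
(* This makes 1 + q and 1 + q^-1 invertible, each having a multiple equal to 2. *)
have nz (x y : k) : x * y = 2 -> x != 0.
  by move=> xy; apply: contra_neq n2 => x0; rewrite -xy x0 mul0r.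
have q1 := sum_opp_root Nodd (prim_expr_order qN).
have qV1 : (1 + q^-1) * \sum_(i < n.+1) (- q^-1) ^+ i = 2.
  by apply: sum_opp_root; rewrite // exprVn (prim_expr_order qN) invr1.
have -> : (4 : k) = 2 * 2 by rewrite -natrM.
rewrite -(mulKf (nz _ _ q1) (\sum_(i < n.+1) (- q) ^+ i)) q1.
rewrite -(mulKf (nz _ _ qV1) (\sum_(i < n.+1) (- q^-1) ^+ i)) qV1.
by rewrite mulrACA -invfM mulrC.
Qed.
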